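(* Let $q$ be a prime power. A $1\times k$ linear system $L=(a_1\ \cdots\ a_k)$ over $\mathbb{F}_q$ is weakly norming if and only if the vector $(a_1,\dots,a_k)$ is Schatten and has no zero entries.
   Context: A $1\times k$ linear system is a non-zero row vector $(a_1,\dots,a_k)\in\mathbb{F}_q^k$, identified with the equation $a_1x_1+\dots+a_kx_k=0$. For $G=\mathbb{F}_q^n$, $\mathrm{Sol}(L)=\{x\in G^k:\sum_j a_jx_j=0\}$ and $t_L(f)=\frac{1}{|\mathrm{Sol}(L)|}\sum_{x\in\mathrm{Sol}(L)}\prod_j f(x_j)$. $L$ is weakly norming if for every $n\ge1$ the functional $f\mapsto t_L(|f|)^{1/k}$ is a norm on the real vector space of real-valued functions on $\mathbb{F}_q^n$. A vector $(a_1,\dots,a_k)$ is Schatten if there is $a\in\mathbb{F}_q$ such that each $a_i\in\{0,a,-a\}$ and $|\{i:a_i=a\}|=|\{i:a_i=-a\}|$.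
   Formalization: ''Schatten'' also requires the number of nonzero entries to be even: automatic in odd characteristic, but in characteristic 2, where a = -a makes the count condition vacuous, the claim is otherwise false, e.g. for the vector (1) over F_2, where t_L(f) = f(0) is not definite. *)

(* Defs.v *)
From HB Require Import structures.
From mathcomp Require Import all_boot all_order all_algebra.
From mathcomp Require Import reals exp.

Set Implicit Arguments.
Unset Strict Implicit.
Unset Printing Implicit Defensive.

Import Order.TTheory GRing.Theory Num.Theory.
Local Open Scope ring_scope.

Section LinearSystem.
Variables (F : finFieldType) (k : nat) (L : 'rV[F]_k).

Definition Sol (n : nat) : {set {ffun 'I_k -> 'rV[F]_n}} :=
  [set x : {ffun 'I_k -> 'rV[F]_n} | \sum_(j < k) L 0 j *: x j == 0].

Definition tL (R : realType) (n : nat) (f : {ffun 'rV[F]_n -> R}) : R :=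
  #|Sol n|%:R^-1 * \sum_(x in Sol n) \prod_(j < k) f (x j).

(* The second condition is meant for the entries of L read as signed copies of
   a.  When a = -a (characteristic 2) a plain count compares a set with itself
   and imposes nothing; there, "as many a as -a" means that the nonzero entries
   split into two classes of equal size, i.e. that their number is even.  The
   third condition says this; when 2 != 0 in F it follows from the other two,
   see [schatten_odd_char]. *)
Definition schatten : Prop :=
  exists a : F,
    [/\ forall i, [\/ L 0 i = 0, L 0 i = a | L 0 i = - a],
        #|[set i | L 0 i == a]| = #|[set i | L 0 i == - a]|
      & ~~ odd #|[set i | L 0 i != 0]|].

Lemma schatten_odd_char : 2%:R != 0 :> F ->
  schatten <->
  exists a : F,
    (forall i, [\/ L 0 i = 0, L 0 i = a | L 0 i = - a]) /\
    #|[set i | L 0 i == a]| = #|[set i | L 0 i == - a]|.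
Proof.
move=> two_neq0; split=> [[a [La cardL _]]|[a [La cardL]]]; exists a; split=> //.
have [a0|a_neq0] := eqVneq a 0.
  rewrite (_ : [set i | _] = set0) ?cards0 //; apply/setP => i.
  by rewrite !inE; case: (La i) => ->; rewrite ?a0 ?oppr0 eqxx.
have aNa : a != - a.
  by rewrite -subr_eq0 opprK -mulr2n -mulr_natl mulf_neq0.
have -> : [set i | L 0 i != 0] = [set i | L 0 i == a] :|: [set i | L 0 i == - a].
  apply/setP => i; rewrite !inE; case: (La i) => ->.
  - by rewrite eqxx [0 == a]eq_sym (negPf a_neq0) eq_sym oppr_eq0 (negPf a_neq0).
  - by rewrite eqxx a_neq0.
  - by rewrite eqxx orbT oppr_eq0 a_neq0.
rewrite cardsU (_ : _ :&: _ = set0) ?cards0 ?subn0 -?cardL ?addnn ?odd_double //.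
apply/setP => i; rewrite !inE.
by apply/negP => /andP[/eqP -> /eqP eqa]; rewrite -eqa eqxx in aNa.
Qed.

End LinearSystem.

(* Nonnegativity follows from the three conditions. *)
Definition is_norm (R : realType) (V : lmodType R) (N : V -> R) : Prop :=
  [/\ forall u v : V, N (u + v) <= N u + N v,
      forall (c : R) (v : V), N (c *: v) = `|c| * N v
    & forall v : V, N v = 0 -> v = 0].

Definition weakly_norming (R : realType) (F : finFieldType) (k : nat)
    (L : 'rV[F]_k) : Prop :=
  forall n : nat, (0 < n)%N ->
    is_norm (fun f : {ffun 'rV[F]_n -> R^o} =>
               tL L [ffun x => `|f x|] `^ k%:R^-1).

(* Main.v *)
Require Import Defs.
From HB Require Import structures.
From mathcomp Require Import all_boot all_order all_algebra.
From mathcomp Require Import ring lra zify.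
From mathcomp Require Import reals exp.

(** If the entries are [a] and [-a], each m times, the solution sum of f is the
value at 0 of the m-th power of f * f~ in the group algebra of F^n, where
f~(x) = f(-x).  For f = u + v with u and v normalised, expand it into words of
length 2m in the letters u, v, u~, v~.  Take a word of maximal value M, isolate
m letters all of type u or all of type v, and apply Cauchy-Schwarz to the
remaining split: M ^ 2 <= 1 * M.  So every word is at most 1, which gives the
triangle inequality.

Conversely, expanding the norm of a sum yields a Hölder inequality with a
constant depending only on k.  Letting n grow, it excludes zero entries, and
on tensor powers the constant disappears: among all vectors c with nonzero
entries, L maximises the solution sum of every h >= 0 on F.  For
h = delta_0 + s delta_1 with s small, this says that L maximises the number of
pairs i < j with c_i + c_j = 0.  Comparison with a vector with half of its
entries 1 and the others -1 forces the entries of L to be a or -a in numbers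
differing by at most one; and the entries sum to 0 because a point mass at a
nonzero vector has nonzero norm.  In characteristic 2 that comparison vector is
constant, so L is constant too, and k is even because the entries sum to 0. *)

Set Implicit Arguments.
Unset Strict Implicit.
Unset Printing Implicit Defensive.
Import Order.TTheory GRing.Theory Num.Theory.
Local Open Scope ring_scope.

(** * The group algebra and words *)

(** A separate name for the function space, so that the ring product put on it can be convolution
    instead of the pointwise product. *)
Definition group_alg (V : finZmodType) (R : comPzRingType) := {ffun V -> R}.

Section GroupAlgebra.
Variables (V : finZmodType) (R : comPzRingType).
Implicit Types f g h : group_alg V R.

HB.instance Definition _ := GRing.Zmodule.on (group_alg V R).

Definition conv f g : group_alg V R := [ffun z => \sum_y f y * g (z - y)].
Definition point_mass (c : R) (v : V) : group_alg V R := [ffun y => c *+ (y == v)].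

Lemma convC : commutative conv.
Proof.
move=> f g; apply/ffunP => z; rewrite !ffunE.
rewrite (reindex_inj (inv_inj (subKr z))) /=.
by apply: eq_bigr => y _; rewrite subKr mulrC.
Qed.

Lemma convA : associative conv.
Proof.
move=> f g h; apply/ffunP => z; rewrite !ffunE.
under [RHS]eq_bigr => y _ do rewrite ffunE big_distrl /=.
rewrite exchange_big /=; apply: eq_bigr => x _.
rewrite ffunE big_distrr /= [RHS](reindex_inj (addIr x)) /=.
by apply: eq_bigr => y _; rewrite addrK mulrA opprD addrA addrAC.
Qed.

Lemma conv1 : left_id (point_mass 1 0) conv.
Proof.
move=> f; apply/ffunP => z; rewrite !ffunE (bigD1 0) //= big1 => [|y /negPf y0].
  by rewrite !ffunE eqxx mul1r subr0 addr0.
by rewrite ffunE y0 mul0r.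
Qed.

Lemma convDl : left_distributive conv +%R.
Proof.
move=> f g h; apply/ffunP => z; rewrite !ffunE -big_split /=.
by apply: eq_bigr => y _; rewrite ffunE mulrDl.
Qed.

HB.instance Definition _ :=
  GRing.Zmodule_isComPzRing.Build (group_alg V R) convA convC conv1 convDl.

Lemma convE f g z : (f * g) z = \sum_y f y * g (z - y).
Proof. by rewrite ffunE. Qed.

Lemma point_massM c d v w : point_mass c v * point_mass d w = point_mass (c * d) (v + w).
Proof.
apply/ffunP => z; rewrite convE (bigD1 v) //= big1 => [|y /negPf yv].
  by rewrite !ffunE eqxx addr0 mulrnAr subr_eq [w + v]addrC.
by rewrite ffunE yv mul0r.
Qed.

Lemma prod_point_mass (I : finType) (c : I -> R) (v : I -> V) :
  \prod_i point_mass (c i) (v i) = point_mass (\prod_i c i) (\sum_i v i).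
Proof.
elim/big_rec3: _ => [|i x y z _ ->]; first by [].
by rewrite point_massM.
Qed.

Lemma group_alg_sum_point_mass f : f = \sum_v point_mass (f v) v.
Proof.
apply/ffunP => z; rewrite sum_ffunE (bigD1 z) //= big1 => [|y /negPf yz].
  by rewrite ffunE eqxx addr0.
by rewrite ffunE eq_sym yz.
Qed.

(** Expand each factor into point masses; a product of point masses is a point mass at the sum of
    their positions. This turns sums over solutions into values of convolution products. *)
Lemma prod_convE (I : finType) (f : I -> group_alg V R) z :
  (\prod_i f i) z =
  \sum_(x : {ffun I -> V} | \sum_i x i == z) \prod_i f i (x i).
Proof.
under eq_bigr => i _ do rewrite [f i]group_alg_sum_point_mass.
rewrite bigA_distr_bigA sum_ffunE [RHS]big_mkcond /=.
apply: eq_bigr => x _; rewrite prod_point_mass ffunE eq_sym.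
by case: eqP.
Qed.

Definition refl f : group_alg V R := [ffun x => f (- x)].

Lemma reflM f g : refl (f * g) = refl f * refl g.
Proof.
apply/ffunP => z; rewrite ffunE !convE (reindex_inj oppr_inj) /=.
by apply: eq_bigr => y _; rewrite !ffunE opprD.
Qed.

Lemma refl1 : refl 1 = 1.
Proof. by apply/ffunP => z; rewrite !ffunE oppr_eq0. Qed.

Lemma reflK : involutive refl.
Proof. by move=> f; apply/ffunP => z; rewrite !ffunE opprK. Qed.

Lemma refl_prod (I : Type) (s : seq I) (f : I -> group_alg V R) :
  refl (\prod_(i <- s) f i) = \prod_(i <- s) refl (f i).
Proof. exact: (big_morph _ reflM refl1). Qed.

Lemma conv_at0 f g : (f * g) 0 = \sum_y f y * refl g y.
Proof. by rewrite convE; apply: eq_bigr => y _; rewrite ffunE sub0r. Qed.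

Lemma conv_refl_at0 f : (f * refl f) 0 = \sum_y f y ^+ 2.
Proof. by rewrite conv_at0; apply: eq_bigr => y _; rewrite reflK. Qed.

End GroupAlgebra.

(** Lagrange's identity: twice the gap is the sum over all i, j of the squares of
    [a i * b j - a j * b i]. *)
Lemma cauchy_schwarz (R : realFieldType) (I : finType) (a b : I -> R) :
  (\sum_i a i * b i) ^+ 2 <= (\sum_i a i ^+ 2) * (\sum_i b i ^+ 2).
Proof.
rewrite -subr_ge0 -(pmulr_rge0 _ (ltr0n R 2)).
have -> : 2%:R * ((\sum_i a i ^+ 2) * (\sum_i b i ^+ 2) - (\sum_i a i * b i) ^+ 2)
   = \sum_i \sum_j (a i * b j - a j * b i) ^+ 2.
  have E u v : (\sum_i u i) * (\sum_i v i) = \sum_i \sum_j u i * v j :> R.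
    by rewrite big_distrl; apply: eq_bigr => i _; rewrite big_distrr.
  rewrite expr2 !E mulrBr mulr_natl mulr2n {2}exchange_big -big_split /=.
  rewrite big_distrr -sumrB /=; apply: eq_bigr => i _.
  rewrite -big_split big_distrr -sumrB /=; apply: eq_bigr => j _; ring.
by apply: sumr_ge0 => i _; apply: sumr_ge0 => j _; exact: sqr_ge0.
Qed.

Section Words.
Variables (V : finZmodType) (R : realFieldType).
Implicit Types f g h : group_alg V R.

(** The value at 0 is the inner product of [f] with [refl g], and reflection preserves the sum of
    squares. *)
Lemma conv_cauchy_schwarz f g :
  (f * g) 0 ^+ 2 <= (f * refl f) 0 * (g * refl g) 0.
Proof.
rewrite conv_at0 !conv_refl_at0; apply: le_trans (cauchy_schwarz _ _) _.
rewrite le_eqVlt; apply/orP; left; apply/eqP; congr (_ * _).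
rewrite (reindex_inj oppr_inj) /=.
by apply: eq_bigr => y _; rewrite ffunE opprK.
Qed.

Variable f : bool -> group_alg V R.

(* Letters: the first boolean selects the function, the second reflects it. *)
Definition letter (l : bool * bool) := if l.2 then refl (f l.1) else f l.1.

Definition flip (l : bool * bool) := (l.1, ~~ l.2).

Lemma letter_flip l : letter (flip l) = refl (letter l).
Proof. by case: l => b [] /=; rewrite /letter /= ?reflK. Qed.

Definition word (s : seq (bool * bool)) : R := (\prod_(l <- s) letter l) 0.

Lemma word_perm s t : perm_eq s t -> word s = word t.
Proof. by move=> st; rewrite /word (perm_big _ st). Qed.

(** Flipping all letters reflects the product P of the word, so each factor on the right is the
    value at 0 of some P * [refl] P. *)
Lemma word_cauchy_schwarz s t :
  word (s ++ t) ^+ 2 <= word (s ++ map flip s) * word (t ++ map flip t).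
Proof.
have E u : word (u ++ map flip u) =
    ((\prod_(l <- u) letter l) * refl (\prod_(l <- u) letter l)) 0.
  rewrite /word big_cat big_map refl_prod.
  suff -> : \prod_(l <- u) letter (flip l) = \prod_(l <- u) refl (letter l) by [].
  by apply: eq_bigr => l _; rewrite letter_flip.
by rewrite !E /word big_cat; exact: conv_cauchy_schwarz.
Qed.

(** Each letter paired with its flip gives [f b * refl (f b)], whether or not the letter was
    reflected. Hence a pure half contributes a value that depends only on its length, and
    normalisation will make it 1. *)
Lemma word_pure b s : all (fun l => l.1 == b) s ->
  word (s ++ map flip s) = ((f b * refl (f b)) ^+ size s) 0.
Proof.
move=> /allP sb; rewrite /word big_cat /= big_map -big_split /=.
rewrite (eq_big_seq (fun=> f b * refl (f b))).
  by rewrite big_const_seq count_predT iter_mulr_1.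
move=> [c e] /sb /= /eqP ->; rewrite /letter; case: e => //=.
by rewrite mulrC.
Qed.

(** Pigeonhole on the first component: one of the two functions occurs at least m times among the 2m
    letters. *)
Lemma perm_split_pure m (s : seq (bool * bool)) : size s = m.*2 ->
  exists b p t, [/\ perm_eq s (p ++ t), all (fun l => l.1 == b) p,
                    size p = m & size t = m].
Proof.
move=> sz_s.
have [b le_m] : exists b, (m <= count (fun l => l.1 == b) s)%N.
  have := count_predC (fun l : bool * bool => l.1 == true) s.
  rewrite sz_s; have [? _|lt_m] := leqP m (count (fun l => l.1 == true) s).
    by exists true.
  move=> E; exists false; rewrite -(leq_add2l m) addnn -E leq_add //.
    exact: ltnW.
  by rewrite leq_eqVlt; apply/orP; left; apply/eqP; apply: eq_count => -[[] ?].
set P := fun l : bool * bool => l.1 == b in le_m *.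
exists b, (take m (filter P s)), (drop m (filter P s) ++ filter (predC P) s).
have szp : size (take m (filter P s)) = m by rewrite size_takel ?size_filter.
split=> //.
- by rewrite catA cat_take_drop perm_sym perm_filterC.
- by apply/allP => l /mem_take; rewrite mem_filter => /andP[].
- rewrite size_cat size_drop !size_filter addnC addnBA // addnC.
  by rewrite count_predC sz_s -addnn addnK.
Qed.

Lemma word_le1 m : (forall b, ((f b * refl (f b)) ^+ m) 0 = 1) ->
  forall s, size s = m.*2 -> word s <= 1.
Proof.
move=> f1 s0 sz0.
pose s1 : (m.*2).-tuple (bool * bool) := nseq_tuple _ (true, true).
have [s _ smax] := @arg_maxP _ _ _ s1 predT (fun s : m.*2.-tuple _ => word s) isT.
have le_max t : size t = m.*2 -> word t <= word s.
  by move=> sz_t; have := smax (Tuple (introT eqP sz_t)) isT.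
apply: le_trans (le_max _ sz0) _.
have [b [p [t [st pb sz_p sz_t]]]] := perm_split_pure (size_tuple s).
have wp : word (p ++ map flip p) = 1 by rewrite (word_pure pb) sz_p.
(* The word [p ++ map flip p] competes for the maximum M and has value 1. So M is positive, and M ^
   2 <= M may be divided by M. *)
have M1 : 1 <= word s by rewrite -wp le_max // size_cat size_map sz_p addnn.
have := word_cauchy_schwarz p t; rewrite -(word_perm st) wp mul1r expr2.
have := le_max (t ++ map flip t); rewrite size_cat size_map sz_t addnn.
move=> /(_ erefl) le1 le2.
by rewrite -(ler_pM2l (lt_le_trans ltr01 M1)) mulr1 (le_trans le2).
Qed.

End Words.

(** * Balanced sign vectors are weakly norming *)

Section SolutionSums.
Variables (R : realType) (F : finFieldType) (k n : nat).
Implicit Types (L : 'rV[F]_k) (g : 'I_k -> 'rV[F]_n -> R).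

Definition solsum L g : R := \sum_(x in Sol L n) \prod_j g j (x j).

Lemma tL_solsum L (f : {ffun 'rV[F]_n -> R}) :
  tL L f = #|Sol L n|%:R^-1 * solsum L (fun=> f).
Proof. by []. Qed.

Lemma eq_solsum L g g' : (forall j, g j =1 g' j) -> solsum L g = solsum L g'.
Proof. by move=> E; apply: eq_bigr => x _; apply: eq_bigr => j _; rewrite E. Qed.

Lemma solsum_ge0 L g : (forall j x, 0 <= g j x) -> 0 <= solsum L g.
Proof. by move=> g0; apply: sumr_ge0 => x _; apply: prodr_ge0. Qed.

Lemma le_solsum L g g' :
  (forall j x, 0 <= g j x <= g' j x) -> solsum L g <= solsum L g'.
Proof. by move=> gg'; apply: ler_sum => x _; apply: ler_prod. Qed.

Lemma solsumZ L (c : R) g : solsum L (fun j x => c * g j x) = c ^+ k * solsum L g.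
Proof.
rewrite /solsum big_distrr; apply: eq_bigr => x _ /=.
by rewrite big_split prodr_const card_ord.
Qed.

(** Substituting t_j x_j for x_j maps the solutions of [L] bijectively onto those of [L'], because
    the equation is only multiplied by [s]. Equations with different nonzero coefficients are
    compared through this substitution. *)
Lemma solsum_scale L L' (t : 'I_k -> F) (s : F) g :
    s != 0 -> (forall j, t j != 0) ->
    (forall j, L' 0 j * t j = s * L 0 j) ->
  solsum L (fun j x => g j (t j *: x)) = solsum L' g.
Proof.
move=> s0 t0 LL'; rewrite /solsum.
have inj_t : injective (fun x : {ffun 'I_k -> 'rV[F]_n} => [ffun j => t j *: x j]).
  move=> x y /ffunP E; apply/ffunP => j; have := E j; rewrite !ffunE.
  exact: scalerI.
rewrite [RHS](reindex_inj inj_t) /=; apply: eq_big => [x|x _]; last first.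
  by apply: eq_bigr => j _; rewrite ffunE.
rewrite !inE; under [in RHS]eq_bigr => j _ do
  rewrite ffunE scalerA LL' -scalerA.
by rewrite -scaler_sumr scaler_eq0 (negPf s0).
Qed.

Lemma Sol0 L : [ffun=> 0] \in Sol L n.
Proof. by rewrite inE big1 // => j _; rewrite ffunE scaler0. Qed.

Lemma card_Sol_gt0 L : 0 < #|Sol L n|%:R :> R.
Proof. by rewrite ltr0n; apply/card_gt0P; exists [ffun=> 0]; exact: Sol0. Qed.

End SolutionSums.

Section Balanced.
Variables (R : realType) (F : finFieldType) (m n : nat).
Local Notation k := m.*2.
Variables (L : 'rV[F]_k) (a : F) (e : 'I_k -> bool).
Hypotheses (a0 : a != 0) (Le : forall j, L 0 j = (-1) ^+ e j * a).
Hypothesis card_e : #|e| = m.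

Lemma card_signC : #|[predC e]| = m.
Proof. by apply: (@addnI m); rewrite -{1}card_e cardC card_ord addnn. Qed.

Lemma sum_signs : \sum_j L 0 j = 0.
Proof.
rewrite (eq_bigr _ (fun j _ => Le j)) (bigID e) /=.
rewrite (eq_bigr (fun=> - a)) => [|j ->]; last by rewrite expr1 mulN1r.
rewrite [X in _ + X](eq_bigr (fun=> a)) => [|j /negPf ->]; last by rewrite mul1r.
by rewrite !sumr_const card_e (card_signC : #|_| = _) mulNrn addNr.
Qed.

(** Rescaling by the signs makes all coefficients 1 and moves each sign into a reflection of the
    function at that place. What remains is a convolution product at 0. *)
Lemma solsum_word (f : bool -> group_alg 'rV[F]_n R) (w : 'I_k -> bool) :
  solsum L (fun j => f (w j) : {ffun _ -> R}) =
  word f [seq (w j, e j) | j <- enum 'I_k].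
Proof.
rewrite /word big_map big_enum prod_convE.
pose g j : {ffun 'rV[F]_n -> R} := letter f (w j, e j).
transitivity (solsum (const_mx 1 : 'rV_k) (fun j => g j)).
  rewrite -[RHS](@solsum_scale _ _ _ _ L _ (fun j => (-1) ^+ e j) a^-1) ?invr_eq0 //.
  - apply: eq_solsum => j x; rewrite /g /letter /=.
    by case: (e j); rewrite ?scale1r // ffunE scaleN1r opprK.
  - by move=> j; rewrite signr_eq0.
  - by move=> j; rewrite mxE mul1r Le mulrCA mulVf ?mulr1.
apply: eq_bigl => x; rewrite inE; congr (_ == _); apply: eq_bigr => j _.
by rewrite mxE scale1r.
Qed.

Lemma solsum_diag (f : group_alg 'rV[F]_n R) :
  solsum L (fun=> f : {ffun _ -> R}) = ((f * refl f) ^+ m) 0.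
Proof.
rewrite (solsum_word (fun=> f) (fun=> true)) /word big_map big_enum /=.
rewrite (bigID e) /= (eq_bigr (fun=> refl f)) => [|j ej]; last first.
  by rewrite /letter /= ej.
rewrite prodr_const card_e (eq_bigr (fun=> f)) => [|j /negPf ej]; last first.
  by rewrite /letter /= ej.
have -> : \prod_(j | ~~ e j) f = f ^+ m.
  by rewrite prodr_const (card_signC : #|_| = _).
by rewrite mulrC exprMn_comm //; exact: mulrC.
Qed.

(** After dividing u by [c] and v by [d], both sides expand over the same choices [w] with the same
    weights; on the left each weight is multiplied by a word, which is at most 1. *)
Lemma solsum_triangle (u v : {ffun 'rV[F]_n -> R}) (c d : R) :
  0 < c -> 0 < d -> solsum L (fun=> u) = c ^+ k -> solsum L (fun=> v) = d ^+ k ->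
  solsum L (fun _ x => u x + v x) <= (c + d) ^+ k.
Proof.
move=> c0 d0 uc vd.
pose s (b : bool) := if b then c else d.
pose f (b : bool) : {ffun 'rV[F]_n -> R} :=
  [ffun x => (s b)^-1 * (if b then u else v) x].
have s_gt0 b : 0 < s b by case: b.
have sf1 b : solsum L (fun=> f b) = 1.
  under eq_solsum => j x do rewrite ffunE.
  rewrite solsumZ exprVn.
  by case: b; rewrite ?uc ?vd mulVf ?expf_neq0 ?gt_eqF.
have -> : solsum L (fun _ x => u x + v x) =
    \sum_(w : {ffun 'I_k -> bool}) (\prod_j s (w j)) * solsum L (fun j => f (w j)).
  under [RHS]eq_bigr => w _ do rewrite big_distrr /=.
  rewrite [RHS]exchange_big /=; apply: eq_bigr => x _.
  have E j : u (x j) + v (x j) = \sum_b s b * f b (x j).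
    by rewrite big_bool /= !ffunE !mulrA !mulfV ?gt_eqF // !mul1r.
  under eq_bigr => j _ do rewrite E.
  by rewrite bigA_distr_bigA; apply: eq_bigr => w _; rewrite big_split.
have -> : (c + d) ^+ k = \sum_(w : {ffun 'I_k -> bool}) \prod_j s (w j).
  transitivity (\prod_(j < k) \sum_b s b); last by rewrite bigA_distr_bigA.
  by rewrite big_bool prodr_const card_ord.
apply: ler_sum => w _; rewrite -[leRHS]mulr1.
apply: ler_wpM2l; first by apply: prodr_ge0 => j _; exact: ltW.
rewrite (solsum_word f); apply: (@word_le1 _ _ f m) => [b|].
  by rewrite -solsum_diag sf1.
by rewrite size_map size_enum_ord.
Qed.

End Balanced.

Lemma card_ord_lt (k m : nat) : (m <= k)%N -> #|[pred j : 'I_k | (j < m)%N]| = m.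
Proof.
move=> mk; rewrite -sum1_card (eq_bigl (fun j : 'I_k => j < m)%N) //.
by rewrite -(big_ord_widen _ (fun=> 1%N)) ?sum1_card ?card_ord.
Qed.

Lemma schatten_signs (F : finFieldType) (k : nat) (L : 'rV[F]_k) :
  L != 0 -> schatten L -> (forall i, L 0 i != 0) ->
  exists m a (e : 'I_k -> bool),
    [/\ k = m.*2, a != 0, forall j, L 0 j = (-1) ^+ e j * a & #|e| = m].
Proof.
move=> L0 [a [La card_a ev]] Lnz.
have /existsP[i0 _] : [exists i : 'I_k, true].
  apply: contraNT L0 => /existsPn no_i; apply/eqP/rowP => i.
  by have := no_i i.
have a0 : a != 0.
  by apply: contraNneq (Lnz i0) => a0; case: (La i0) => ->; rewrite ?a0 ?oppr0.
have [aNa|aNa] := eqVneq a (- a).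
  (* Here all entries equal [a] and signs have no effect, so any half of the indices can carry the
     minus signs. The parity condition makes [k] even. *)
  exists k./2, a, (fun j => j < k./2)%N.
  have k_ev : k = k./2.*2.
    rewrite even_halfK //; move: ev; rewrite (_ : [set i | _] = setT).
      by rewrite cardsT card_ord.
    by apply/setP => i; rewrite !inE Lnz.
  split=> // [j|].
    have N1 : -1 = 1 :> F by apply: (mulIf a0); rewrite mulN1r mul1r.
    rewrite N1 expr1n mul1r; case: (La j) => [E|//|->]; last by rewrite -aNa.
    by have := Lnz j; rewrite E eqxx.
  by apply: card_ord_lt; rewrite -{2}[k]odd_double_half -addnn addnA leq_addl.
have L_eq j : (L 0 j == a) = ~~ (L 0 j == - a).
  case: (La j) => E; first by have := Lnz j; rewrite E eqxx.
    by rewrite E eqxx aNa.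
  by rewrite E eqxx eq_sym (negPf aNa).
exists #|[set i | L 0 i == - a]|, a, (fun j => L 0 j == - a); split=> //.
- rewrite -[LHS](card_ord k) -(cardsC [set i | L 0 i == - a]).
  rewrite -addnn; congr (_ + _)%N; rewrite -card_a; apply: eq_card => i.
  by rewrite !inE L_eq.
- move=> j; case: eqP => [->|/eqP]; first by rewrite expr1 mulN1r.
  by rewrite -L_eq expr0 mul1r => /eqP.
- by rewrite cardsE.
Qed.

Section Root.
Variables (R : realType) (k : nat).
Hypothesis k0 : (0 < k)%N.

Lemma powR_rootK (x : R) : 0 <= x -> (x `^ k%:R^-1) ^+ k = x.
Proof.
move=> x0; rewrite -powR_mulrn ?powR_ge0 // -powRrM mulVf ?pnatr_eq0 -?lt0n //.
by rewrite powRr1.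
Qed.

Lemma exprK_powR (x : R) : 0 <= x -> (x ^+ k) `^ k%:R^-1 = x.
Proof.
move=> x0; rewrite -powR_mulrn // -powRrM mulfV ?pnatr_eq0 -?lt0n //.
by rewrite powRr1.
Qed.

Lemma powR_root_eq0 (x : R) : (x `^ k%:R^-1 == 0) = (x == 0).
Proof. by rewrite powR_eq0 invr_eq0 pnatr_eq0 -lt0n k0 andbT. Qed.

Lemma ler_root (x y : R) : 0 <= x -> x <= y -> x `^ k%:R^-1 <= y `^ k%:R^-1.
Proof.
move=> x0 xy; apply: ge0_ler_powR => //; first by rewrite invr_ge0 ler0n.
by rewrite nnegrE (le_trans x0).
Qed.

End Root.

Lemma balanced_weakly_norming (R : realType) (F : finFieldType) (m : nat)
    (L : 'rV[F]_(m.*2)) (a : F) (e : 'I_(m.*2) -> bool) :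
  (0 < m)%N -> a != 0 -> (forall j, L 0 j = (-1) ^+ e j * a) -> #|e| = m ->
  weakly_norming R L.
Proof.
move=> m0 a0 Le card_e n n0; set k := m.*2 in L e Le card_e *.
have k0 : (0 < k)%N by rewrite double_gt0.
pose S (f : {ffun 'rV[F]_n -> R}) := solsum L (fun _ x => `|f x|).
set N : _ -> R := fun f => _.
have S0 f : 0 <= S f by apply: solsum_ge0.
have NE f : N f = #|Sol L n|%:R^-1 `^ k%:R^-1 * S f `^ k%:R^-1.
  rewrite /N tL_solsum powRM //; last first.
  - by apply: solsum_ge0 => j x; rewrite ffunE.
  - by rewrite invr_ge0 ltW ?card_Sol_gt0.
  congr (_ * _ `^ _); apply: eq_solsum => j x; by rewrite ffunE.
have kap : 0 < #|Sol L n|%:R^-1 `^ k%:R^-1 :> R.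
  by rewrite powR_gt0 // invr_gt0 card_Sol_gt0.
(* Since the entries of [L] sum to 0, every constant tuple is a solution, so the k-th power of |f x|
   is one of the nonnegative terms of [S f]. *)
have S_eq0 f : S f = 0 -> f = 0.
  move=> /eqP Sf0; apply/ffunP => x; rewrite ffunE; apply/eqP.
  move: Sf0; rewrite psumr_eq0 => [|y _]; last exact: prodr_ge0.
  move=> /allP /(_ [ffun=> x] (mem_index_enum _)).
  rewrite inE (eq_bigr (fun j => L 0 j *: x)) => [|j _]; last by rewrite ffunE.
  rewrite -scaler_suml (sum_signs Le card_e) scale0r eqxx /=.
  under eq_bigr => j _ do rewrite ffunE.
  by rewrite prodr_const card_ord expf_eq0 k0 /= normr_eq0.
split=> [u v|c v|v].
- rewrite !NE -mulrDr ler_pM2l //.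
  (* [solsum_triangle] divides by both norms, so vanishing norms are treated first. *)
  have [u0|/eqP uN0] := eqVneq (S u) 0.
    by rewrite (S_eq0 _ u0) add0r lerDr powR_ge0.
  have [v0|/eqP vN0] := eqVneq (S v) 0.
    by rewrite (S_eq0 _ v0) addr0 lerDl powR_ge0.
  set c := S u `^ _; set d := S v `^ _.
  have c0 : 0 < c by rewrite powR_gt0 // lt_neqAle S0 andbT eq_sym; apply/eqP.
  have d0 : 0 < d by rewrite powR_gt0 // lt_neqAle S0 andbT eq_sym; apply/eqP.
  rewrite -(exprK_powR k0 (ltW (addr_gt0 c0 d0))) ler_root //.
  have uc : solsum L (fun=> [ffun x => `|u x|]) = c ^+ k.
    rewrite powR_rootK //; apply: eq_solsum => j x; by rewrite ffunE.
  have vd : solsum L (fun=> [ffun x => `|v x|]) = d ^+ k.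
    rewrite powR_rootK //; apply: eq_solsum => j x; by rewrite ffunE.
  apply: le_trans (solsum_triangle a0 Le card_e c0 d0 uc vd).
  apply: le_solsum => j x; rewrite !ffunE normr_ge0 /=; exact: ler_normD.
- rewrite !NE.
  have -> : S (c *: v) = `|c| ^+ k * S v.
    by rewrite /S -solsumZ; apply: eq_solsum => j x; rewrite ffunE normrM.
  by rewrite powRM ?exprn_ge0 // exprK_powR // mulrCA.
- rewrite NE => /eqP; rewrite mulf_eq0 (gt_eqF kap) powR_root_eq0 //= => /eqP.
  exact: S_eq0.
Qed.

(** * A Hölder inequality up to a constant *)

(** If a > b, Bernoulli's inequality makes (a / b) ^ n exceed any constant. This is what removes [K]
    after passing to tensor powers. *)
Lemma le_of_exprn_le (R : archiRealFieldType) (a b K : R) :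
  0 < b -> (forall n, (0 < n)%N -> a ^+ n <= K * b ^+ n) -> a <= b.
Proof.
move=> b0 le_ab; rewrite leNgt; apply/negP => lt_ba.
pose x := a / b - 1.
have x0 : 0 < x by rewrite subr_gt0 ltr_pdivlMr // mul1r.
have bernoulli n : 1 + n%:R * x <= (1 + x) ^+ n.
  elim: n => [|n IHn]; first by rewrite mul0r addr0.
  rewrite exprS -natr1; have : 0 <= n%:R * x ^+ 2 by rewrite mulr_ge0 ?sqr_ge0.
  have := ler_wpM2l (ltW (addr_gt0 ltr01 x0)) IHn; lra.
pose n := (Num.bound (`|K| / x)).+1.
have Kn : K < n%:R * x.
  rewrite -ltr_pdivrMr //; apply: le_lt_trans (_ : `|K| / x < _).
    by rewrite ler_pM2r ?invr_gt0 // ler_norm.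
  apply: lt_trans (archi_boundP _) _; first by rewrite divr_ge0 // ltW.
  by rewrite ltr_nat.
have := le_ab n isT; have -> : a = (1 + x) * b by rewrite addrC subrK divfK ?gt_eqF.
rewrite exprMn ler_pM2r ?exprn_gt0 //; have := bernoulli n; lra.
Qed.

Section Necessity.
Variables (R : realType) (F : finFieldType) (k : nat) (L : 'rV[F]_k).
Hypotheses (k0 : (0 < k)%N) (wnL : weakly_norming R L).

(* Apply the triangle inequality to the sum of the g_i and keep one term of the
   expansion.  The factor k^k is later removed by a tensor power trick. *)
Lemma weak_holder n (g : 'I_k -> 'rV[F]_n -> R) (s : R) : (0 < n)%N ->
    (forall j x, 0 <= g j x) -> (forall i, solsum L (fun=> g i) <= s) ->
  solsum L g <= k%:R ^+ k * s.
Proof.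
move=> n0 g0 gs.
pose N (f : {ffun 'rV[F]_n -> R^o}) := tL L [ffun x => `|f x|] `^ k%:R^-1.
have [trN homN _] : is_norm N := wnL n0.
pose G i : {ffun 'rV[F]_n -> R^o} := [ffun x => g i x].
have kap : 0 < #|Sol L n|%:R^-1 :> R by rewrite invr_gt0 card_Sol_gt0.
have NE (f : {ffun 'rV[F]_n -> R^o}) : (forall x, 0 <= f x) ->
    N f = (#|Sol L n|%:R^-1 * solsum L (fun=> f)) `^ k%:R^-1.
  move=> f0; rewrite /N tL_solsum; congr ((_ * _) `^ _).
  by apply: eq_solsum => j x; rewrite ffunE ger0_norm.
have N_sum : N (\sum_i G i) <= \sum_i N (G i).
  elim/big_rec2: _ => [|i y z _ le_zy].
    by rewrite -[in N _](scale0r 0) homN normr0 mul0r.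
  by apply: le_trans (trN _ _) _; rewrite lerD2l.
have sumGE x : (\sum_i G i) x = \sum_i g i x.
  by rewrite sum_ffunE; apply: eq_bigr => i _; rewrite ffunE.
have sumG0 x : 0 <= (\sum_i G i) x by rewrite sumGE sumr_ge0.
have s0 : 0 <= s.
  by apply: le_trans (gs (Ordinal k0)); apply: solsum_ge0.
have NG i : N (G i) <= (#|Sol L n|%:R^-1 * s) `^ k%:R^-1.
  rewrite NE => [|x]; last by rewrite ffunE.
  rewrite (eq_solsum L (_ : forall j, G i =1 g i)) => [|j x]; last by rewrite ffunE.
  apply: ler_root; first by rewrite mulr_ge0 ?solsum_ge0 // ltW.
  by rewrite ler_pM2l.
have : N (\sum_i G i) <= k%:R * (#|Sol L n|%:R^-1 * s) `^ k%:R^-1.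
  apply: le_trans N_sum _; apply: le_trans (ler_sum _ (fun i _ => NG i)) _.
  by rewrite sumr_const card_ord mulr_natl.
rewrite NE // => /(lerXn2r k); rewrite !nnegrE powR_ge0 mulr_ge0 ?powR_ge0 //.
move=> /(_ isT isT); rewrite exprMn !powR_rootK //; first last.
- by rewrite mulr_ge0 ?solsum_ge0 // ltW.
- by rewrite mulr_ge0 // ltW.
rewrite mulrCA ler_pM2l //; apply: le_trans.
apply: le_solsum => j x; rewrite g0 sumGE (bigD1 j) //= lerDl.
by rewrite sumr_ge0.
Qed.

(** For the point mass at a nonzero v, only the tuple constantly equal to v gives a nonzero product.
    Were the sum of the entries nonzero, this tuple would not be a solution, and a nonzero function
    would have norm 0. *)
Lemma weakly_norming_sum0 : \sum_j L 0 j = 0.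
Proof.
have [_ _ /(_ [ffun x => (x == const_mx 1)%:R])] := wnL (ltn0Sn 0).
set N := (X in X = 0 -> _) => N_eq0.
apply/eqP; apply: contraT => sumL.
suff /N_eq0 /ffunP /(_ (const_mx 1)) : N = 0.
  by rewrite !ffunE eqxx => /eqP; rewrite oner_eq0.
rewrite /N tL_solsum /solsum big1 ?mulr0 => [|x]; last first.
  rewrite inE => Lx; have [j xj] : exists j, x j != const_mx 1.
    apply/existsP; apply: contraNT sumL => /existsPn x1.
    move: Lx; rewrite (eq_bigr (fun j => L 0 j *: const_mx 1)) => [|j _].
      by rewrite -scaler_suml => /eqP /rowP /(_ 0); rewrite !mxE mulr1 => ->.
    by have := x1 j; rewrite negbK => /eqP ->.
  by rewrite (bigD1 j) //= !ffunE (negPf xj) normr0 mul0r.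
by rewrite powR0 // invr_eq0 pnatr_eq0 -lt0n.
Qed.

End Necessity.

(** * Tensor powers and pairs of opposite entries *)

Section ScalarSums.
Variables (R : realType) (F : finFieldType) (k : nat).
Implicit Types (c : 'rV[F]_k) (h : F -> R).

(** The one-dimensional solution sum, with field elements in place of row vectors of length 1; it is
    the base of the tensor powers. *)
Definition scalar_sum c h : R :=
  \sum_(y : {ffun 'I_k -> F} | \sum_j c 0 j * y j == 0) \prod_j h (y j).

Lemma scalar_sum_gt0 c h :
  (forall y, 0 <= h y) -> 0 < h 0 -> 0 < scalar_sum c h.
Proof.
move=> h_ge0 h0; rewrite /scalar_sum (bigD1 [ffun=> 0]) /=; last first.
  by apply/eqP; rewrite big1 // => j _; rewrite ffunE mulr0.
apply: ltr_wpDr; first by apply: sumr_ge0 => y _; apply: prodr_ge0.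
by apply: prodr_gt0 => j _; rewrite ffunE.
Qed.

(** Read a k-tuple of vectors as an n-tuple of coordinate slices: the equation holds exactly when it
    holds in every slice, and the weight is a product over slices. *)
Lemma solsum_tensor n c h :
  solsum c (fun _ (x : 'rV[F]_n) => \prod_l h (x 0 l)) = scalar_sum c h ^+ n.
Proof.
have -> : scalar_sum c h ^+ n = \prod_(l < n) scalar_sum c h.
  by rewrite prodr_const card_ord.
under eq_bigr => l _ do rewrite /scalar_sum big_mkcond.
rewrite bigA_distr_bigA /=.
pose tr (x : {ffun 'I_k -> 'rV[F]_n}) : {ffun 'I_n -> {ffun 'I_k -> F}} :=
  [ffun l => [ffun j => x j 0 l]].
have tr_bij : bijective tr.
  exists (fun y : {ffun 'I_n -> {ffun 'I_k -> F}} => [ffun j => \row_l y l j]) => [x|y].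
    by apply/ffunP => j; rewrite ffunE; apply/rowP => l; rewrite !mxE !ffunE.
  by apply/ffunP => l; apply/ffunP => j; rewrite !ffunE mxE.
rewrite (reindex tr) /=; last exact: onW_bij.
rewrite /solsum big_mkcond; apply: eq_bigr => x _; rewrite inE.
have E l : \sum_j c 0 j * tr x l j = (\sum_j c 0 j *: x j) 0 l.
  by rewrite summxE; apply: eq_bigr => j _; rewrite !ffunE mxE.
case: eqP => [c0|/eqP /rV0Pn [l cl]]; last first.
  by rewrite (bigD1 l) //= E (negPf cl) mul0r.
rewrite exchange_big; apply: eq_bigr => l _ /=.
rewrite E c0 mxE eqxx; apply: eq_bigr => j _; by rewrite !ffunE.
Qed.

(** Put g_j(x) = H(t_j x) with t_j = L_j / c_j. Used together in the equation [L], the g_j give the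
    solution sum of H for [c]; a single g_i used at all places gives that of H for [L], as scaling
    all variables alike preserves solutions. Now [weak_holder] compares n-th powers up to a constant
    independent of n. *)
Lemma scalar_sum_max (L : 'rV[F]_k) c h :
    (0 < k)%N -> weakly_norming R L ->
    (forall j, L 0 j != 0) -> (forall j, c 0 j != 0) ->
    (forall y, 0 <= h y) -> 0 < h 0 ->
  scalar_sum c h <= scalar_sum L h.
Proof.
move=> k0 wnL L0 c0 h_ge0 h0.
apply: (@le_of_exprn_le _ _ _ (k%:R ^+ k)); first exact: scalar_sum_gt0.
move=> n n0; rewrite -!solsum_tensor.
set H := fun x : 'rV[F]_n => \prod_l h (x 0 l).
have t0 j : L 0 j / c 0 j != 0 by rewrite mulf_neq0 ?invr_eq0.
have cL j : c 0 j * (L 0 j / c 0 j) = 1 * L 0 j by rewrite mul1r mulrC divfK.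
rewrite -(solsum_scale (fun=> H) (oner_neq0 F) t0 cL).
apply: (weak_holder k0 wnL n0) => [j x|i]; first exact: prodr_ge0.
rewrite le_eqVlt; apply/orP; left; apply/eqP.
have LL j : L 0 j * (L 0 i / c 0 i) = L 0 i / c 0 i * L 0 j by rewrite mulrC.
exact: (solsum_scale (fun=> H) (t0 i) (fun=> t0 i) LL).
Qed.

(* The number of pairs i < j with c_i + c_j = 0 is the coefficient of s ^+ 2 in
   [scalar_sum c] at the function delta_0 + s delta_1. *)
Definition zero_pairs c : {set {set 'I_k}} :=
  [set B : {set 'I_k} | (#|B| == 2) && (\sum_(j in B) c 0 j == 0)].

Definition two_point (s : R) (y : F) : R :=
  if y == 0 then 1 else if y == 1 then s else 0.

(** Only tuples with values 0 and 1 count. They are the indicators of sets B, and solve the equation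
    when the entries over B sum to 0. *)
Lemma scalar_sum_two_point c s :
  scalar_sum c (two_point s) =
  \sum_(B : {set 'I_k} | \sum_(j in B) c 0 j == 0) s ^+ #|B|.
Proof.
pose ind (B : {set 'I_k}) : {ffun 'I_k -> F} := [ffun j => (j \in B)%:R].
rewrite /scalar_sum.
rewrite (bigID (fun y : {ffun _ -> F} => [forall j, (y j == 0) || (y j == 1)])) /=.
rewrite [X in _ + X]big1 ?addr0 => [|y /andP[_ /forallPn[j]]]; last first.
  rewrite negb_or => /andP[y0 y1].
  by rewrite (bigD1 j) //= /two_point (negPf y0) (negPf y1) mul0r.
rewrite (reindex_onto ind (fun y => [set j | y j == 1])) /=; last first.
  move=> y /andP[_ /forallP y01]; apply/ffunP => j; rewrite ffunE inE.
  by case/orP: (y01 j) => /eqP ->; rewrite ?eqxx // eq_sym oner_eq0.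
apply: eq_big => [B|B _].
  rewrite (_ : [set j | _] = B) ?eqxx ?andbT; last first.
    apply/setP => j; rewrite inE ffunE.
    by case: (j \in B); rewrite ?eqxx // eq_sym oner_eq0.
  rewrite [X in _ && X](_ : _ = true) ?andbT; last first.
    by apply/forallP => j; rewrite ffunE; case: (j \in B); rewrite eqxx ?orbT.
  congr (_ == _); rewrite [RHS]big_mkcond; apply: eq_bigr => j _.
  by rewrite ffunE; case: (j \in B); rewrite ?mulr1 ?mulr0.
rewrite -prodr_const [RHS]big_mkcond; apply: eq_bigr => j _.
by rewrite ffunE /two_point; case: (j \in B); rewrite ?oner_eq0 ?eqxx.
Qed.

(** The terms of degree 0 and 2 written as a sum over all sets, so that the next two bounds can be
    checked set by set. *)
Lemma sum_zero_pairs c (s : R) :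
  \sum_(B : {set 'I_k}) (((B == set0)%:R + (B \in zero_pairs c)%:R * s ^+ 2) : R) =
  1 + #|zero_pairs c|%:R * s ^+ 2.
Proof.
rewrite big_split -big_distrl -!natr_sum /= -!big_mkcond /= !sum1_card.
by rewrite (eq_card1 (x := set0)).
Qed.

Lemma scalar_sum_two_point_ge c s : 0 <= s ->
  1 + #|zero_pairs c|%:R * s ^+ 2 <= scalar_sum c (two_point s).
Proof.
move=> s0; rewrite scalar_sum_two_point -sum_zero_pairs big_mkcond /=.
rewrite [leRHS]big_mkcond /=; apply: ler_sum => B _.
have [->|B0] := eqVneq B set0.
  by rewrite inE big_set0 eqxx cards0 /= mul0r addr0.
rewrite inE add0r; case: eqP => [->|_]; first by case: ifP; rewrite ?mul1r ?mul0r.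
by rewrite mul0r; case: ifP => // _; rewrite exprn_ge0.
Qed.

(** Nonzero entries exclude one-element sets. Every set beyond the empty one and the zero pairs thus
    has at least three elements and contributes at most s ^ 3, and there are at most 2 ^ k of
    them. *)
Lemma scalar_sum_two_point_le c s : (forall j, c 0 j != 0) -> 0 <= s <= 1 ->
  scalar_sum c (two_point s) <=
  1 + #|zero_pairs c|%:R * s ^+ 2 + (2 ^ k)%:R * s ^+ 3.
Proof.
move=> c0 /andP[s0 s1]; rewrite scalar_sum_two_point -sum_zero_pairs.
have -> : (2 ^ k)%:R * s ^+ 3 = \sum_(B : {set 'I_k}) s ^+ 3.
  by rewrite sumr_const -cardsT -powersetT card_powerset cardsT card_ord mulr_natl.
rewrite -big_split big_mkcond /=; apply: ler_sum => B _.
have s3 : 0 <= s ^+ 3 by rewrite exprn_ge0.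
case: ifP => [Bc|_]; last by rewrite !addr_ge0 ?mulr_ge0 ?ler0n ?exprn_ge0.
have [->|B0] := eqVneq B set0.
  by rewrite inE cards0 /= mul0r addr0 lerDl.
rewrite inE Bc andbT add0r.
have [B2|B_neq2] := eqVneq #|B| 2; first by rewrite B2 mul1r lerDl.
rewrite mul0r add0r ler_wiXn2l //.
rewrite ltn_neqAle eq_sym B_neq2 /= ltn_neqAle card_gt0 B0 andbT eq_sym.
apply: contraTneq Bc => /eqP /cards1P[j ->].
by rewrite big_set1.
Qed.

Lemma card_zero_pairs_max (L : 'rV[F]_k) c :
    (0 < k)%N -> weakly_norming R L ->
    (forall j, L 0 j != 0) -> (forall j, c 0 j != 0) ->
  (#|zero_pairs c| <= #|zero_pairs L|)%N.
Proof.
move=> k0 wnL L0 c0; rewrite -ltnS -(ltr_nat R).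
(* With this [s] the cubic error is half of s ^ 2, too little to hide a difference of one between
   the two integer coefficients. *)
pose s : R := (2 ^ k.+1)%:R^-1.
have s_gt0 : 0 < s by rewrite invr_gt0 ltr0n expn_gt0.
have s1 : s <= 1 by rewrite invf_le1 ?ltr0n ?expn_gt0 // ler1n expn_gt0.
have ks : (2 ^ k)%:R * s = 2^-1.
  by rewrite /s expnS natrM invfM mulrCA mulfV ?mulr1 // pnatr_eq0 expn_eq0.
have tp_ge0 y : 0 <= two_point s y.
  by rewrite /two_point; do 2!case: ifP => // _; exact: ltW.
have tp0 : 0 < two_point s 0 by rewrite /two_point eqxx ltr01.
have := scalar_sum_max k0 wnL L0 c0 tp_ge0 tp0.
move=> /(le_trans (scalar_sum_two_point_ge c (ltW s_gt0))).
have s01 : 0 <= s <= 1 by rewrite ltW.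
move=> /le_trans /(_ (scalar_sum_two_point_le L0 s01)).
rewrite -addrA lerD2l [s ^+ 3]exprS [_ * (s * s ^+ 2)]mulrA ks.
rewrite -mulrDl ler_pM2r ?exprn_gt0 //.
rewrite -[#|_|.+1%:R]natr1; lra.
Qed.

End ScalarSums.

(** * Zero entries *)

(** Adding v to the i-th coordinate of a solution changes the value of the equation from 0 to L_i v.
    So v and the solution can be recovered from the shifted tuple, and all shifts are distinct. *)
Lemma card_Sol_le (F : finFieldType) (k n : nat) (L : 'rV[F]_k) (i : 'I_k) :
  L 0 i != 0 -> (#|'rV[F]_n| * #|Sol L n| <= #|'rV[F]_n| ^ k)%N.
Proof.
move=> Li.
pose phi (p : 'rV[F]_n * {ffun 'I_k -> 'rV[F]_n}) : {ffun 'I_k -> 'rV[F]_n} :=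
  [ffun j => p.2 j + (j == i)%:R *: p.1].
have phiE p : p.2 \in Sol L n -> \sum_j L 0 j *: phi p j = L 0 i *: p.1.
  rewrite inE => /eqP p0; under eq_bigr => j _ do rewrite ffunE scalerDr.
  rewrite big_split /= p0 add0r (bigD1 i) //= big1 => [|j /negPf ->].
    by rewrite eqxx scale1r addr0.
  by rewrite scale0r scaler0.
have inj_phi : {in setX setT (Sol L n) &, injective phi}.
  move=> [v x] [w y]; rewrite !in_setX => /andP[_ xL] /andP[_ yL] E.
  have vw : v = w.
    by apply: (scalerI Li); rewrite -(phiE (v, x)) // -(phiE (w, y)) // E.
  congr (_, _) => //; apply/ffunP => j; move/ffunP: E => /(_ j).
  by rewrite !ffunE /= vw; exact: addIr.
rewrite -[k in (_ ^ k)%N]card_ord -card_ffun -[#|'rV[F]_n| in leqLHS]cardsT -cardsX.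
by rewrite -(card_in_imset inj_phi) max_card.
Qed.

(* Test functions: delta_0 at the nonzero entries, and at the zero entries the
   constant for which the left side grows with the dimension. *)
Lemma weakly_norming_no_zero (R : realType) (F : finFieldType) (k : nat)
    (L : 'rV[F]_k) :
  L != 0 -> weakly_norming R L -> forall i, L 0 i != 0.
Proof.
move=> /rV0Pn [i1 Li1] wnL i0; apply/eqP => Li0.
have k0 : (0 < k)%N by apply: leq_ltn_trans (ltn_ord i0).
pose N := (k ^ k)%N; pose q := #|F|.
have q1 : (1 < q)%N := card_finNzRing_gt1 _.
have N0 : (0 < N)%N by rewrite expn_gt0 k0.
pose n := (k * N)%N; have n0 : (0 < n)%N by rewrite muln_gt0 k0.
have cardV : #|'rV[F]_n| = (q ^ n)%N by rewrite card_mx mul1n.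
(* There are at most q ^ (n (k - 1)) solutions, so [lam ^+ k] times their number is at most 1. But a
   zero entry leaves its variable free and yields the factor q ^ n * lam = q ^ N, which exceeds the
   constant N = k ^ k of [weak_holder]. *)
pose lam : R := (q ^ (N * k.-1))%:R^-1.
have qX_gt0 m : 0 < (q ^ m)%:R :> R by rewrite ltr0n expn_gt0 ltnW.
have lam0 : 0 <= lam by rewrite invr_ge0 ltW.
pose g j (x : 'rV[F]_n) : R := if L 0 j == 0 then lam else (x == 0)%:R.
have g0 j x : 0 <= g j x by rewrite /g; case: ifP.
have g1 i : solsum L (fun=> g i) <= 1.
  have [Li|/negPf Li] := eqVneq (L 0 i) 0.
    rewrite /solsum (eq_bigr (fun=> lam ^+ k)) => [|x _]; last first.
      rewrite (eq_bigr (fun=> lam)) => [|j _]; last by rewrite /g Li eqxx.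
      by rewrite prodr_const card_ord.
    rewrite sumr_const -mulr_natl exprVn ler_pdivrMr ?exprn_gt0 // mul1r.
    rewrite -natrX ler_nat -expnM.
    have qn0 : (0 < q ^ n)%N by rewrite expn_gt0 ltnW.
    rewrite -(leq_pmul2l qn0) -[in leqLHS]cardV.
    apply: leq_trans (card_Sol_le n Li1) _; rewrite cardV -expnM -expnD.
    have E p M : (p.+1 * M * p.+1 = p.+1 * M + M * p * p.+1)%N by ring.
    by have := E k.-1 N; rewrite prednK // => ->.
  rewrite (eq_solsum L (g' := fun _ x => (x == 0)%:R)) => [|j x]; last first.
    by rewrite /g Li.
  rewrite /solsum (bigD1 [ffun=> 0]) ?Sol0 //= [X in _ + X]big1 => [|x /andP[_]].
    by rewrite addr0 big1 // => j _; rewrite ffunE eqxx.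
  move=> x0; have [j xj] : exists j, x j != 0.
    apply/existsP; apply: contraNT x0 => /existsPn x0; apply/eqP/ffunP => j.
    by rewrite ffunE; have := x0 j; rewrite negbK => /eqP.
  by rewrite (bigD1 j) //= (negPf xj) mul0r.
have := weak_holder k0 wnL n0 g0 g1; rewrite mulr1 -natrX -/N.
(* Where the product is nonzero, x_j = 0 at every nonzero entry, so the equation holds automatically
   and the sum factors over the coordinates. *)
have -> : solsum L g = \prod_j \sum_v g j v.
  rewrite bigA_distr_bigA [RHS](bigID (mem (Sol L n))) /=.
  rewrite [X in _ = _ + X]big1 ?addr0 // => x; rewrite inE => xL.
  have [j /andP[Lj xj]] : exists j, (L 0 j != 0) && (x j != 0).
    apply/existsP; apply: contraNT xL => /existsPn no_j; apply/eqP.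
    apply: big1 => j _; have := no_j j; rewrite negb_and !negbK.
    by case/orP => /eqP ->; rewrite ?scale0r ?scaler0.
  by rewrite (bigD1 j) //= /g (negPf Lj) (negPf xj) mul0r.
have sum_g j : \sum_v g j v = if L 0 j == 0 then (q ^ N)%:R else 1.
  rewrite /g; case: (L 0 j == 0).
    rewrite sumr_const cardV -[lam *+ _]mulr_natr.
    apply: (mulIf (lt0r_neq0 (qX_gt0 (N * k.-1)%N))).
    by rewrite mulrC mulVKf ?gt_eqF // -natrM -expnD -mulnS prednK // mulnC.
  by rewrite (bigD1 0) //= eqxx big1 ?addr0 // => v /negPf ->.
under eq_bigr => j _ do rewrite sum_g.
rewrite (bigD1 i0) //= Li0 eqxx => le_qN.
have : (q ^ N)%:R <= N%:R :> R.
  apply: le_trans le_qN; rewrite ler_peMr ?(ltW (qX_gt0 _)) //.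
  elim/big_ind: _ => // [x y|j _]; first exact: mulr_ege1.
  by case: ifP => _; rewrite ?lexx // ler1n expn_gt0 (ltnW q1).
by rewrite ler_nat leqNgt ltn_expl.
Qed.

(** * Counting pairs of opposite entries *)

Section ZeroPairs.
Variables (F : finFieldType) (k : nat).
Implicit Type c : 'rV[F]_k.

(** The degree of [i] in the graph whose edges are the [zero_pairs]. *)
Definition zero_degree c (i : 'I_k) : nat :=
  #|[set j | (j != i) && (c 0 i + c 0 j == 0)]|.

(** The handshake lemma: count incidences of an index with a pair in two ways. *)
Lemma sum_zero_degree c : (\sum_i zero_degree c i)%N = (2 * #|zero_pairs c|)%N.
Proof.
have -> : (2 * #|zero_pairs c|)%N = (\sum_(B in zero_pairs c) \sum_(i in B) 1)%N.
  rewrite mulnC -sum_nat_const; apply: eq_bigr => B.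
  by rewrite inE sum1_card => /andP[/eqP ->].
rewrite (exchange_big_dep predT) //=; apply: eq_bigr => i _.
rewrite sum1_card /zero_degree -(card_in_imset (f := fun j => [set i; j])).
  apply: eq_card => B; apply/imsetP/idP => [[j]|].
    rewrite !inE => /andP[ji c0] ->.
    have ij : i != j by rewrite eq_sym.
    by rewrite unfold_in /= inE cards2 ij big_setU1 ?inE //= big_set1 c0 eqxx.
  rewrite unfold_in /= inE => /andP[/andP[/cards2P[x [y [xy ->]]] c0]].
  rewrite !inE => /orP[] /eqP iE.
    exists y; rewrite iE // inE eq_sym xy -(eqP c0) big_setU1 ?inE //=.
    by rewrite big_set1.
  exists x; rewrite iE; last by rewrite setUC.
  by rewrite inE xy -(eqP c0) big_setU1 ?inE //= big_set1 addrC.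
move=> j j'; rewrite !inE => /andP[ji _] /andP[j'i _] /setP /(_ j).
by rewrite !inE eqxx orbT (negPf ji) /= => /esym /eqP.
Qed.

End ZeroPairs.

(** * Vectors with the most pairs of opposite entries *)

(** The graph is complete bipartite between the two sign classes. *)
Lemma sum_zero_degree_signs (F : finFieldType) (k : nat) (c : 'rV[F]_k)
    (a : F) (e : 'I_k -> bool) :
    a != - a -> (forall j, c 0 j = (-1) ^+ e j * a) ->
  (\sum_i zero_degree c i = 2 * (#|e| * #|[predC e]|))%N.
Proof.
move=> aNa ce.
have dE i : zero_degree c i = if e i then #|[predC e]| else #|e|.
  have -> : zero_degree c i = #|[pred j | e j != e i]|.
    apply: eq_card => j; rewrite !inE addr_eq0 !ce.
    have [->|ji /=] := eqVneq j i.
      by rewrite !eqxx.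
    by case: (e i); case: (e j); rewrite /= ?expr1 ?expr0 ?mulN1r ?mul1r ?opprK
      ?eqxx ?(negPf aNa) // eq_sym (negPf aNa).
  by case: (e i); apply: eq_card => j; rewrite !inE unfold_in; case: (e j).
rewrite (eq_bigr _ (fun i _ => dE i)) (bigID e) /=.
rewrite (eq_bigr (fun=> #|[predC e]|)) => [|i ->] //.
rewrite [X in (_ + X)%N](eq_bigr (fun=> #|e|)) => [|i /negPf ->] //.
by rewrite !sum_nat_const [X in (_ + X)%N]mulnC addnn -mul2n.
Qed.

(* Each entry b contributes n_b n_(-b) on the left and n_b ^ 2 on the right,
   where n_b is the number of entries equal to b. *)
Lemma sum_card_opp_le (F : finFieldType) (k : nat) (c : 'rV[F]_k) :
  (\sum_i #|[pred j | (c 0 j == - c 0 i)%R]| <=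
   \sum_i #|[pred j | (c 0 j == c 0 i)%R]|)%N.
Proof.
pose n b := #|[pred j | c 0 j == b]|.
have E (f : F -> F) : (\sum_i n (f (c 0%R i)) = \sum_b n b * n (f b))%N.
  rewrite (partition_big (fun i => c 0 i) predT) //=; apply: eq_bigr => b _.
  by rewrite (eq_bigr (fun=> n (f b))) => [|i /eqP -> //]; rewrite sum_nat_const.
rewrite (E -%R) (E id) -(leq_pmul2l (ltn0Sn 1)).
have -> : (2 * \sum_b n b * n b = \sum_b (n b ^ 2 + n (- b)%R ^ 2))%N.
  rewrite big_split /= [X in _ = (_ + X)%N](reindex_inj oppr_inj) /= mul2n -addnn.
  by congr (_ + _)%N; apply: eq_bigr => b _; rewrite ?opprK expnS expn1.
by rewrite big_distrr; apply: leq_sum => b _; exact: nat_Cauchy.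
Qed.

Section Extremal.
Variables (R : realType) (F : finFieldType) (k : nat) (L : 'rV[F]_k).
Hypotheses (k0 : (0 < k)%N) (L0 : forall i, L 0 i != 0).
Hypothesis wnL : weakly_norming R L.

Lemma sum_zero_degree_max (c : 'rV[F]_k) : (forall i, c 0 i != 0) ->
  (\sum_i zero_degree c i <= \sum_i zero_degree L i)%N.
Proof.
by move=> c0; rewrite !sum_zero_degree leq_pmul2l // (card_zero_pairs_max k0 wnL).
Qed.

Lemma schatten_char2 : 2%:R = 0 :> F -> schatten L.
Proof.
move=> two0; have opp (x : F) : - x = x.
  by apply/eqP; rewrite eq_sym -addr_eq0 -mulr2n -mulr_natl two0 mul0r.
have d_le (c : 'rV[F]_k) i : (zero_degree c i <= k.-1)%N.
  rewrite /zero_degree -[k in leqRHS]card_ord -(cardC1 i).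
  by apply/subset_leq_card/subsetP => j; rewrite !inE => /andP[].
pose i0 := Ordinal k0.
have Leq j : L 0 j = L 0 i0.
  apply/eqP; apply/negPn/negP => Lj.
  have lt_d : (zero_degree L i0 < k.-1)%N.
    rewrite /zero_degree -[k in ltnRHS]card_ord -(cardC1 i0).
    apply/proper_card/properP; split.
      by apply/subsetP => i; rewrite !inE => /andP[].
    have ji : j != i0 by apply: contraNneq Lj => ->.
    by exists j; rewrite !inE // ji /= addr_eq0 opp eq_sym.
  (* In characteristic 2 every pair of entries of [ones] sums to 0, so all its degrees are k - 1. As
     [L] is extremal, none of its degrees can be smaller, contrary to [lt_d]. *)
  pose ones : 'rV[F]_k := const_mx 1.
  have ones0 i : ones 0 i != 0 by rewrite mxE oner_neq0.
  have := sum_zero_degree_max ones0.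
  have -> : (\sum_i zero_degree ones i = \sum_(i < k) k.-1)%N.
    apply: eq_bigr => i _; rewrite /zero_degree -[k in RHS]card_ord -(cardC1 i).
    by apply: eq_card => l; rewrite !inE !mxE -mulr2n two0 eqxx andbT.
  rewrite (bigD1 i0) // [leqRHS](bigD1 i0) //= leqNgt; apply/negP; rewrite negbK.
  rewrite -addSn leq_add // leq_sum => // i _; exact: d_le.
exists (L 0 i0); split=> [i||]; first by constructor 2.
  by rewrite opp.
apply: contra_eqN (weakly_norming_sum0 k0 wnL) => odd_nz.
rewrite (eq_bigr (fun=> L 0 i0)) => [|j _]; last exact: Leq.
have k_odd : odd k.
  by move: odd_nz; rewrite (_ : [set i | _] = setT) ?cardsT ?card_ord //;
    apply/setP => i; rewrite !inE L0.
(* An odd number of copies of a nonzero element sums to that element, while the entries of [L] sum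
   to 0. *)
have dbl (x : F) : x *+ k = x.
  rewrite -mulr_natl -(odd_double_half k) k_odd natrD.
  by rewrite -mul2n natrM two0 mul0r addr0 mul1r.
by rewrite sumr_const card_ord dbl L0.
Qed.

Lemma schatten_odd : 2%:R != 0 :> F -> schatten L.
Proof.
move=> two_neq0.
have neqN (x : F) : x != 0 -> x != - x.
  by move=> x0; rewrite -subr_eq0 opprK -mulr2n -mulr_natl mulf_neq0.
pose D i := #|[pred j | L 0 j == - L 0 i]|.
pose E i := #|[pred j | L 0 j == L 0 i]|.
pose M i := #|[pred j | (L 0 j != L 0 i) && (L 0 j != - L 0 i)]|.
have DE i : zero_degree L i = D i.
  apply: eq_card => j; rewrite !inE addrC addr_eq0.
  by have [->|] := eqVneq j i; rewrite ?(negPf (neqN _ (L0 i))).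
have DEM i : (D i + E i + M i = k)%N.
  rewrite -[RHS]card_ord -(cardC [pred j | (L 0 j == L 0 i) || (L 0 j == - L 0 i)]).
  congr (_ + _)%N; last by apply: eq_card => j; rewrite !inE negb_or.
  rewrite addnC -cardUI [X in (_ + X)%N]eq_card0 ?addn0; last first.
    move=> j; rewrite !inE; apply/negP => /andP[/eqP-> /eqP].
    by apply/eqP; exact: neqN.
  by apply: eq_card => j; rewrite !inE.
(* The parity of [k] is not yet known, so the comparison vector has sign classes as equal as
   possible. *)
pose p := k./2; pose q := (k - k./2)%N.
have pk : (p <= k)%N by rewrite /p; lia.
have sumD : (2 * (p * q) <= \sum_i D i)%N.
  pose e (j : 'I_k) := (j < p)%N.
  have := @sum_zero_degree_signs F k (\row_j (-1) ^+ e j) 1 e (neqN _ (oner_neq0 _)).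
  have card_e : #|e| = p := card_ord_lt pk.
  have card_eC : #|[predC e]| = q.
    by apply: (@addnI p); rewrite -{1}card_e cardC card_ord subnKC.
  rewrite card_e card_eC => <- => [|j]; last by rewrite mxE mulr1.
  rewrite -(eq_bigr _ (fun i _ => DE i)); apply: sum_zero_degree_max => j.
  by rewrite mxE signr_eq0.
(* Extremality gives sum D >= 2pq, and sum E >= sum D. The total being k ^ 2, at most k ^ 2 - 4pq <=
   1 is left for sum M. *)
have sumM : (\sum_i M i <= 1)%N.
  have : (\sum_i (D i + E i + M i) = k * k)%N.
    by rewrite (eq_bigr _ (fun i _ => DEM i)) sum_nat_const card_ord.
  rewrite !big_split /= => sumk.
  have leDE : (\sum_i D i <= \sum_i E i)%N := sum_card_opp_le L.
  have : (k * k <= 4 * (p * q) + 1)%N.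
    rewrite /p /q; have := odd_double_half k.
    case: (odd k) => <-; set h := k./2; nia.
  move: sumk leDE sumD.
  move: (\sum_i D i)%N (\sum_i E i)%N (\sum_i M i)%N (p * q)%N (k * k)%N; lia.
(* Being neither equal nor opposite is symmetric, so a positive [M i] comes with a positive [M j]
   for another index, and the sum would be at least 2. *)
have M0 i : M i = 0%N.
  apply/eqP; rewrite -leqn0 leqNgt; apply/negP => Mi.
  case/card_gt0P: (Mi) => j; rewrite inE => /andP[ji jNi].
  have Mj : (0 < M j)%N.
    apply/card_gt0P; exists i; rewrite inE eq_sym ji /=.
    by rewrite -[L 0 i]opprK (inj_eq oppr_inj) eq_sym.
  have ij : j != i by apply: contraNneq ji => ->.
  by move: sumM; rewrite (bigD1 i) //= (bigD1 j) //=; lia.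
pose a := L 0 (Ordinal k0); pose e j := L 0 j == - a.
have aNa : a != - a by apply: neqN; exact: L0.
have Le j : L 0 j = (-1) ^+ e j * a.
  rewrite /e; have [->|jN] := eqVneq; first by rewrite expr1 mulN1r.
  have := card0_eq (M0 (Ordinal k0)) j; rewrite inE -/a jN andbT => /negbFE /eqP.
  by rewrite expr0 mul1r.
apply/(schatten_odd_char L two_neq0); exists a.
have pq : (#|e| + #|[predC e]| = k)%N by rewrite cardC card_ord.
have prod_pq : (p * q <= #|e| * #|[predC e]|)%N.
  rewrite -(leq_pmul2l (ltn0Sn 1)) -(sum_zero_degree_signs aNa Le).
  by rewrite (eq_bigr _ (fun i _ => DE i)).
have sumL : a *+ #|[predC e]| = a *+ #|e|.
  have := weakly_norming_sum0 k0 wnL; rewrite (bigID e) /=.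
  rewrite (eq_bigr (fun=> - a)) => [|j ej]; last by rewrite Le ej expr1 mulN1r.
  rewrite [X in _ + X](eq_bigr (fun=> a)) => [|j /negPf ej]; last first.
    by rewrite Le ej expr0 mul1r.
  by rewrite !sumr_const mulNrn addrC => /eqP; rewrite subr_eq0 => /eqP.
(* The bound on the product forces the two class sizes to differ by at most one. A difference of
   exactly one would make the sum of the entries a or -a, which is not 0. *)
have pq_eq : #|[predC e]| = #|e|.
  move: prod_pq pq sumL; rewrite /p /q; move: #|_| #|_| => x y le_xy xyk sumL.
  have : [\/ x = y, x = y.+1 | y = x.+1].
    have : (x <= y.+1)%N /\ (y <= x.+1)%N.
      by have := odd_double_half k; rewrite -xyk in le_xy *; nia.
    case=> xy yx; case: (ltngtP x y) => ?; last by constructor 1.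
      by constructor 3; lia.
    by constructor 2; lia.
  have a0 : a != 0 := L0 _.
  have absurd z : a *+ z = a *+ z.+1 -> x = y.
    by move/eqP; rewrite mulrS -[X in X == _]add0r (inj_eq (addIr _)) eq_sym (negPf a0).
  by case=> [//|xy|xy]; [apply: (absurd y) | apply: (absurd x)]; rewrite -xy.
split=> [i|].
  by rewrite Le; case: (e i); rewrite ?expr1 ?mulN1r ?expr0 ?mul1r;
     [constructor 3 | constructor 2].
have -> : #|[set i | L 0 i == - a]| = #|e| by rewrite cardsE.
rewrite -pq_eq; apply: eq_card => j; rewrite !inE -[j \in e]/(e j) Le.
by case: (e j); rewrite ?expr1 ?mulN1r ?expr0 ?mul1r ?eqxx // eq_sym (negPf aNa).
Qed.

End Extremal.

Theorem theorem5p2 (R : realType) (F : finFieldType) (k : nat) (L : 'rV[F]_k)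
    (hL : L != 0) :
  weakly_norming R L <-> schatten L /\ (forall i : 'I_k, L 0 i != 0).
Proof.
split=> [wnL|[schL L0]].
  have /rV0Pn[i0 _] := hL; have k0 : (0 < k)%N := leq_ltn_trans (leq0n _) (ltn_ord i0).
  have L0 := weakly_norming_no_zero hL wnL; split=> //.
  have [two0|two_neq0] := eqVneq (2%:R : F) 0; first exact: schatten_char2 wnL _.
  exact: schatten_odd wnL _.
have [m [a [e [km a0 Le card_e]]]] := schatten_signs hL schL L0.
have /rV0Pn[i0 _] := hL.
move: L e hL schL L0 Le card_e i0; rewrite km => L e _ _ _ Le card_e i0.
apply: balanced_weakly_norming a0 Le card_e.
by rewrite -double_gt0; apply: leq_ltn_trans (ltn_ord i0).
Qed.
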